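(* Let $G$ be a $d$-$(u,v)$-universally diametrical graph of order $n$, size $m\geq n+2d+4$, and minimum degree $\delta(G)\geq 2$. Let $G^*$ be the graph obtained from $G$ by attaching a new pendant vertex $u'$ to $u$ and a new pendant vertex $v'$ to $v$. If $E_2(G)>E_1(G)$, then $E_2(G^* )>E_1(G^* )$.
   Context: All graphs are finite, simple, connected. $\varepsilon_G(w)=\max_x d_G(w,x)$ is the eccentricity, ${\rm diam}(G)=\max_w\varepsilon_G(w)$, and ${\rm Ecc}_G(w)=\{x: d_G(w,x)=\varepsilon_G(w)\}$. Vertices $u,v$ are diametrical if $d_G(u,v)={\rm diam}(G)$. $G$ is universally diametrical with universally diametrical pair $u,v$ if $u,v$ are diametrical and ${\rm Ecc}_G(w)\cap\{u,v\}\neq\emptyset$ for every $w\in V(G)\setminus\{u,v\}$; it is $d$-$(u,v)$-universally diametrical if moreover $d_G(u,v)={\rm diam}(G)=d$. $E_1(G)=\sum_w\varepsilon_G(w)^2$ and $E_2(G)=\sum_{xy\in E(G)}\varepsilon_G(x)\varepsilon_G(y)$. *)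

(* Defs.v *)
From mathcomp Require Import all_boot.

Set Implicit Arguments.
Unset Strict Implicit.
Unset Printing Implicit Defensive.

Record sgraph := SGraph {
  vertex :> finType;
  adj : rel vertex;
  adj_sym : symmetric adj;
  adj_irrefl : irreflexive adj }.

Section Graph.
Variable G : sgraph.
Implicit Types u v w x y : G.

Definition edges : {set {set G}} :=
  [set A : {set G} | [exists x, exists y, adj x y && (A == [set x; y])]].

Definition gorder : nat := #|G|.
Definition gsize : nat := #|edges|.

Definition degree x : nat := #|[set y | adj x y]|.

(* The neutral element [gorder] exceeds every degree, hence is never attained
   on a nonempty graph. *)
Definition min_degree : nat := \big[minn/gorder]_(x : G) degree x.

Definition connected : Prop := forall x y, connect (@adj G) x y.

Definition walk_of_length k x y : bool :=
  [exists p : k.-tuple G, path (@adj G) x p && (last x p == y)].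

(* The least length of a walk from x to y. A shortest walk has length less
   than [gorder]; the value is [gorder] when y is not reachable from x. *)
Definition dist x y : nat :=
  find (fun k => walk_of_length k x y) (iota 0 gorder).

Definition ecc x : nat := \max_(y : G) dist x y.
Definition diam : nat := \max_(x : G) ecc x.
Definition Ecc x : {set G} := [set y | dist x y == ecc x].

Definition diametrical u v : Prop := dist u v = diam.

Definition universally_diametrical u v : Prop :=
  diametrical u v /\
  forall w, w \notin [set u; v] -> Ecc w :&: [set u; v] != set0.

Definition d_universally_diametrical (d : nat) u v : Prop :=
  universally_diametrical u v /\ diam = d.

Definition E1 : nat := \sum_(w : G) ecc w ^ 2.

(* An edge A is an unordered pair {x, y} with x != y, so the inner product is
   ecc x * ecc y. *)
Definition E2 : nat := \sum_(A in edges) \prod_(x in A) ecc x.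

Lemma dist_le x y (p : seq G) :
  path (@adj G) x p -> last x p = y -> dist x y <= size p.
Proof.
move=> xp lp; rewrite /dist leqNgt; apply/negP => lt.
have lt' : size p < gorder.
  by apply: leq_trans lt _; rewrite (leq_trans (find_size _ _)) ?size_iota.
have /negP := negbT (before_find 0 lt); apply; rewrite nth_iota // add0n.
by apply/existsP; exists (in_tuple p); rewrite /= xp lp eqxx.
Qed.

Lemma dist_walk x y : connect (@adj G) x y ->
  exists p : seq G, [/\ path (@adj G) x p, last x p = y & size p = dist x y].
Proof.
case/connectP => p0 /shortenP[p xp up _] ->.
have lt : size p < gorder.
  by have := max_card (mem (x :: p)); rewrite (card_uniqP up).
have hasp : has (fun k => walk_of_length k x (last x p)) (iota 0 gorder).
  apply/hasP; exists (size p); first by rewrite mem_iota.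
  by apply/existsP; exists (in_tuple p); rewrite /= xp eqxx.
have := nth_find 0 hasp; rewrite has_find size_iota in hasp.
rewrite nth_iota // add0n => /existsP[q /andP[xq /eqP lq]].
by exists q; rewrite size_tuple.
Qed.

Section Pendant.
Variable u : G.

Definition pendant_adj : rel (option G) := fun a b =>
  match a, b with
  | Some x, Some y => adj x y
  | Some x, None | None, Some x => x == u
  | None, None => false
  end.

Lemma pendant_sym : symmetric pendant_adj.
Proof. by case=> [x|] [y|] //=; apply: adj_sym. Qed.

Lemma pendant_irrefl : irreflexive pendant_adj.
Proof. by case=> [x|] //=; apply: adj_irrefl. Qed.

(* The new pendant vertex is [None]. *)
Definition attach_pendant : sgraph := SGraph pendant_sym pendant_irrefl.

End Pendant.
End Graph.

Definition Gstar (G : sgraph) (u v : G) : sgraph :=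
  @attach_pendant (attach_pendant u) (Some v).

(* Main.v *)
Require Import Defs.
From mathcomp Require Import all_boot zify.

(** Every vertex of [G] gains exactly 1 in eccentricity when the two pendant
    vertices are attached, and both new vertices have eccentricity [d + 2].
    Hence
      [E2 G* - E1 G* = (E2 G - E1 G) + \sum_x (deg x - 2) * ecc x
                       + (m - n - 2d - 4)],
    where the last two terms are nonnegative. *)

Set Implicit Arguments.
Unset Strict Implicit.
Unset Printing Implicit Defensive.

(** * Distances in a connected graph *)

Section Distance.
Variable G : sgraph.
Implicit Types x y z : G.

Lemma lipschitz_path (f : G -> nat) x (p : seq G) :
  (forall y z, adj y z -> f z <= (f y).+1) ->
  path (@adj G) x p -> f (last x p) <= f x + size p.
Proof.
move=> lipf; elim: p x => [|y p IHp] x /=; first by rewrite addn0.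
move=> /andP[/lipf xy /IHp yp]; lia.
Qed.

Lemma distxx x : dist x x = 0.
Proof. by apply/eqP; rewrite -leqn0 (@dist_le _ _ _ [::]). Qed.

Hypothesis conG : connected G.

(** Source of lower bounds on distances: an explicit function that grows by at most 1 along each
    edge bounds the distance from below, without any analysis of walks. *)
Lemma lipschitz_dist (f : G -> nat) x y :
  (forall z t, adj z t -> f t <= (f z).+1) -> f y <= f x + dist x y.
Proof.
move=> lipf; have [p [xp <- <-]] := dist_walk (conG x y).
exact: lipschitz_path.
Qed.

Lemma dist_adj x y z : adj y z -> dist x z <= (dist x y).+1.
Proof.
move=> yz; have [p [xp lp <-]] := dist_walk (conG x y).
rewrite -(size_rcons p z); apply: dist_le; last by rewrite last_rcons.
by rewrite rcons_path xp lp.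
Qed.

Lemma dist_sym x y : dist x y = dist y x.
Proof.
suff le (a b : G) : dist a b <= dist b a by apply/eqP; rewrite eqn_leq !le.
have [p [bp lp <-]] := dist_walk (conG b a).
(* The walk [b :: p] read backwards starts at [a] and continues with [rev (belast b p)]. *)
rewrite -(size_belast b) -size_rev; apply: dist_le; last first.
  by rewrite -lp; case: p {bp lp} => //= c p; rewrite rev_cons last_rcons.
rewrite -lp rev_path.
by apply: sub_path bp => s t st; rewrite adj_sym.
Qed.

End Distance.

(** * Sums over unordered edges, via ordered pairs *)

Section EdgeSum.
Variable G : sgraph.

Definition edge_sum (f : G -> nat) : nat :=
  \sum_(A in edges G) \prod_(x in A) f x.

(** The map [(x, y) |-> [set x; y]] from ordered adjacent pairs to edges has fibres of size exactly
    two. *)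
Lemma double_edge_sum f :
  2 * edge_sum f = \sum_(x : G) \sum_(y : G | adj x y) f x * f y.
Proof.
rewrite pair_big_dep /=.
rewrite (partition_big (fun p => [set p.1; p.2]) (mem (edges G))) /=; last first.
  move=> [x y] /= xy; rewrite inE; apply/existsP; exists x.
  by apply/existsP; exists y; rewrite xy eqxx.
rewrite /edge_sum big_distrr; apply: eq_bigr => A.
rewrite inE => /existsP[x /existsP[y /andP[xy /eqP ->]]].
have nxy : x != y by apply: contraTneq xy => ->; rewrite adj_irrefl.
rewrite big_setU1 ?inE //= big_set1.
rewrite (bigD1 (x, y)) /=; last by rewrite xy eqxx.
rewrite (bigD1 (y, x)) /=; last first.
  by rewrite adj_sym xy setUC eqxx xpair_eqE eq_sym (negbTE nxy).
rewrite big1 ?addn0 => [|[a b] /=]; first by rewrite (mulnC (f y)) mul2n addnn.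
(* Any further pair in the fibre would have [a = b], against irreflexivity. *)
case/andP => /andP[/andP[ab /eqP eqA]].
have : a \in [set x; y] by rewrite -eqA !inE eqxx.
have : b \in [set x; y] by rewrite -eqA !inE eqxx orbT.
rewrite !inE => /orP[] /eqP bE /orP[] /eqP aE; subst a b;
  by rewrite ?eqxx ?andbF //; rewrite adj_irrefl in ab.
Qed.

(** Expand [(f x + 1) * (f y + 1)]: each vertex [x] receives a linear term [f x] from each of its
    edges, and the constants count the edges. *)
Lemma edge_sumS f :
  edge_sum (fun x => (f x).+1)
    = edge_sum f + \sum_(x : G) degree x * f x + gsize G.
Proof.
have sizeE : gsize G = edge_sum (fun=> 1).
  by rewrite /edge_sum /gsize -sum1_card; apply: eq_bigr => A _; rewrite big1.
have degE : \sum_(x : G) degree x * f x = \sum_(x : G) \sum_(y | adj x y) f x.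
  by apply: eq_bigr => x _; rewrite sum_nat_const /degree cardsE.
have degE' : \sum_(x : G) degree x * f x = \sum_(x : G) \sum_(y | adj x y) f y.
  rewrite degE (exchange_big_dep predT) //=; apply: eq_bigr => y _.
  by apply: eq_bigl => x; rewrite adj_sym.
apply/eqP; rewrite -(eqn_pmul2l (isT : 0 < 2)) !mulnDr sizeE !double_edge_sum.
(* Of the two copies of the degree sum, one supplies the terms [f x] and the other the terms
   [f y]. *)
rewrite mul2n -addnn {1}degE degE' -!big_split /=; apply/eqP.
apply: eq_bigr => x _; rewrite -!big_split /=; apply: eq_bigr => y _; lia.
Qed.

Lemma min_degreeP k : k <= min_degree G -> forall x : G, k <= degree x.
Proof.
move=> kmin x; apply: leq_trans kmin _; rewrite /min_degree.
elim: (index_enum _) (mem_index_enum x) => //= y s IHs.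
rewrite inE big_cons geq_min => /predU1P[->|/IHs ->]; first by rewrite leqnn.
by rewrite orbT.
Qed.

End EdgeSum.

Section OptionBig.
Variables (R : Type) (idx : R) (op : Monoid.com_law idx) (T : finType).

(** Separates the pendant vertex from the old ones, in sums as well as in maxima. *)
Lemma big_option_type (F : option T -> R) :
  \big[op/idx]_a F a = op (F None) (\big[op/idx]_x F (Some x)).
Proof.
rewrite (bigD1 None) //=; congr (op _ _).
rewrite (reindex_omap Some id) => [|[x|]] //=.
by apply: eq_bigl => x; rewrite eqxx.
Qed.

End OptionBig.

(** * Attaching one pendant vertex *)

Section Pendant.
Variables (G : sgraph) (u : G).
Let H := attach_pendant u.
Hypothesis conG : connected G.

Lemma path_pendant x p :
  path (@adj H) (Some x) (map Some p) = path (@adj G) x p.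
Proof. by elim: p x => //= y p IHp x; rewrite IHp. Qed.

Lemma connect_pendant_Some (x y : G) :
  connect (@adj H) (Some x) (Some y).
Proof.
have /connectP[p xp ->] := conG x y.
by apply/connectP; exists (map Some p); rewrite ?path_pendant ?last_map.
Qed.

Lemma connected_pendant : connected H.
Proof.
have uN x : connect (@adj H) (Some x) None.
  by apply: connect_trans (connect_pendant_Some x u) (connect1 _); rewrite /= eqxx.
have Nu x : connect (@adj H) None (Some x).
  by apply: connect_trans (connect1 _) (connect_pendant_Some u x); rewrite /= eqxx.
by move=> [x|] [y|] //; apply: connect_pendant_Some.
Qed.

(** The left side, as a function of [b], vanishes at [Some x] and changes by at most 1 along every
    edge of [H], so the pendant vertex creates no shortcut. *)
Lemma dist_pendant_ge (x : G) (b : H) :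
  oapp (dist x) (dist x u).+1 b <= @dist H (Some x) b.
Proof.
have := @lipschitz_dist H connected_pendant (oapp (dist x) (dist x u).+1) (Some x) b.
rewrite /= distxx; apply=> -[z|] [t|] //=; first exact: dist_adj.
  by move=> /eqP->.
by move=> /eqP->; rewrite !leqW.
Qed.

Lemma dist_pendant_Some (x y : G) : @dist H (Some x) (Some y) = dist x y.
Proof.
apply/eqP; rewrite eqn_leq (dist_pendant_ge x (Some y)) andbT.
have [p [xp <- <-]] := dist_walk (conG x y).
by rewrite -(size_map Some p); apply: dist_le; rewrite ?path_pendant ?last_map.
Qed.

Lemma dist_pendant_None (x : G) : @dist H (Some x) None = (dist x u).+1.
Proof.
apply/eqP; rewrite eqn_leq (dist_pendant_ge x None) andbT.
rewrite -dist_pendant_Some; apply: dist_adj; first exact: connected_pendant.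
by rewrite /= eqxx.
Qed.

(** After doubling, the only new ordered pairs are [(None, Some u)] and [(Some u, None)]. *)
Lemma edge_sum_pendant (f : H -> nat) :
  edge_sum f = edge_sum (fun x : G => f (Some x)) + f None * f (Some u).
Proof.
apply/eqP; rewrite -(eqn_pmul2l (isT : 0 < 2)) mulnDr !double_edge_sum.
rewrite big_option_type big_mkcond big_option_type /= add0n -big_mkcond /=.
rewrite big_pred1_eq.
under [X in _ + X]eq_bigr => x _ do
  rewrite big_mkcond big_option_type /= -big_mkcond.
rewrite big_split /= -big_mkcond big_pred1_eq; apply/eqP; lia.
Qed.

End Pendant.

(** * Eccentricities and both indices after attaching two pendant vertices *)

Section Gstar.
Variables (G : sgraph) (d : nat) (u v : G).
Hypothesis conG : connected G.
Hypothesis diamG : d_universally_diametrical d u v.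

Let dist_ecc (x y : G) : dist x y <= ecc x.
Proof. exact: (leq_bigmax (F := dist x)). Qed.

Let ecc_diam (x : G) : ecc x <= d.
Proof. by case: diamG => _ <-; apply: (leq_bigmax (F := @ecc G)). Qed.

Let dist_uv : dist u v = d.
Proof. by case: diamG => -[-> _] ->. Qed.

(** The definition speaks only of vertices other than [u] and [v]; these two are at distance [d]
    from each other, the largest possible. *)
Lemma ecc_attained (x : G) : (dist x u == ecc x) || (dist x v == ecc x).
Proof.
have [|] := boolP (x \in [set u; v]).
  have := dist_ecc x u; have := dist_ecc x v; have := ecc_diam x.
  rewrite !inE => le_d le_v le_u /orP[] /eqP xE; subst x.
    by rewrite dist_uv in le_v *; lia.
  by rewrite (dist_sym conG v u) dist_uv in le_u *; lia.
case: diamG => -[_ univ] _ /univ /set0Pn[y]; rewrite !inE.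
by case/andP => xy /orP[] /eqP yE; rewrite -yE xy ?orbT.
Qed.

Let conH : connected (attach_pendant u).
Proof. exact: connected_pendant. Qed.

(** In [Gstar u v], [None] is the pendant at [v] and [Some None] the one at [u]. They lie at
    distances [(dist x v).+1] and [(dist x u).+1] from [x], and by [ecc_attained] the larger of
    these is [(ecc x).+1]. *)
Lemma ecc_Gstar (x : G) : @ecc (Gstar u v) (Some (Some x)) = (ecc x).+1.
Proof.
rewrite /ecc !big_option_type /= dist_pendant_None // dist_pendant_Some //.
rewrite dist_pendant_Some // dist_pendant_None //.
under eq_bigr do rewrite dist_pendant_Some // dist_pendant_Some //.
rewrite -/(ecc x).
by have := dist_ecc x u; have := dist_ecc x v; case/orP: (ecc_attained x) => /eqP; lia.
Qed.

(** The maximum is attained at the other pendant vertex, through [u] and [v]. *)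
Lemma ecc_Gstar_u : @ecc (Gstar u v) (Some None) = d.+2.
Proof.
rewrite /ecc !big_option_type /= dist_pendant_None // dist_pendant_Some // distxx.
rewrite (dist_sym conH) dist_pendant_None // (dist_sym conG) dist_uv max0n.
suff le : \max_(x : G) @dist (Gstar u v) (Some None) (Some (Some x)) <= d.+2.
  exact/maxn_idPl.
apply/bigmax_leqP => x _; rewrite dist_pendant_Some // (dist_sym conH).
rewrite dist_pendant_None // !ltnS leqW //.
exact: leq_trans (dist_ecc x u) (ecc_diam x).
Qed.

Lemma ecc_Gstar_v : @ecc (Gstar u v) None = d.+2.
Proof.
have conS := @connected_pendant (attach_pendant u) (Some v) conH.
rewrite /ecc !big_option_type /= distxx max0n (dist_sym conS).
rewrite dist_pendant_None // (dist_sym conH) dist_pendant_None //.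
rewrite (dist_sym conG) dist_uv; apply/maxn_idPl/bigmax_leqP => x _.
rewrite (dist_sym conS) dist_pendant_None // dist_pendant_Some // !ltnS leqW //.
exact: leq_trans (dist_ecc x v) (ecc_diam x).
Qed.

Lemma ecc_u : ecc u = d.
Proof. by apply/eqP; rewrite eqn_leq ecc_diam -{1}dist_uv dist_ecc. Qed.

Lemma ecc_v : ecc v = d.
Proof. by apply/eqP; rewrite eqn_leq ecc_diam -{1}dist_uv (dist_sym conG) dist_ecc. Qed.

Lemma E1_Gstar :
  E1 (Gstar u v) = E1 G + 2 * \sum_(x : G) ecc x + gorder G + 2 * d.+2 ^ 2.
Proof.
rewrite /E1 !big_option_type /= ecc_Gstar_u ecc_Gstar_v.
under eq_bigr do rewrite ecc_Gstar.
rewrite /gorder -sum1_card big_distrr -!big_split /= [RHS]addnC addnA addnn -mul2n.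
by congr (_ + _); apply: eq_bigr => x _; lia.
Qed.

(** The old edges are handled by [edge_sumS]; each of the two pendant edges joins eccentricities
    [d.+2] and [d.+1]. *)
Lemma E2_Gstar :
  E2 (Gstar u v)
    = E2 G + \sum_(x : G) degree x * ecc x + gsize G + 2 * (d.+2 * d.+1).
Proof.
rewrite -[LHS]/(edge_sum (@ecc (Gstar u v))) -[E2 G]/(edge_sum (@ecc G)).
rewrite !edge_sum_pendant /= ecc_Gstar_u ecc_Gstar_v !ecc_Gstar ecc_u ecc_v.
rewrite -edge_sumS -addnA addnn -mul2n; congr (_ + _).
apply: eq_bigr => A _; apply: eq_bigr => x _; exact: ecc_Gstar.
Qed.

End Gstar.

Theorem theorem4p3 (G : sgraph) (d : nat) (u v : G) :
  connected G ->
  d_universally_diametrical d u v ->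
  gorder G + 2 * d + 4 <= gsize G ->
  2 <= min_degree G ->
  E1 G < E2 G ->
  E1 (Gstar u v) < E2 (Gstar u v).
Proof.
move=> conG diamG size_ge deg_ge E12.
rewrite (E1_Gstar conG diamG) (E2_Gstar conG diamG).
have : 2 * \sum_(x : G) ecc x <= \sum_(x : G) degree x * ecc x.
  rewrite big_distrr; apply: leq_sum => x _.
  by rewrite leq_mul2r min_degreeP ?orbT.
(* The new vertices add [2 * d.+2 ^ 2] to [E1] and the new edges [2 * (d.+2 * d.+1)] to [E2]; the
   deficit [2 * d + 4] is covered by [size_ge]. *)
move: (\sum_(x : G) ecc x) (\sum_(x : G) degree x * ecc x) => s t; lia.
Qed.
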